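(* Let $t>s\ge 2$ and $n\ge 2(s+t)-3$ be integers. Then $$\mathrm{wsat}(K_n,K_{s,t})\le (s-1)(n-s)+\binom{t}{2}.$$
   Context: All graphs are finite and simple; $K_n$ is the complete graph on $n$ vertices and $K_{a,b}$ is the complete bipartite graph with parts of sizes $a$ and $b$. A copy of a graph $H$ in a graph $G$ is a (not necessarily induced) subgraph of $G$ isomorphic to $H$. Let $F$ and $H$ be graphs. A spanning subgraph $G$ of $F$ is weakly $(F,H)$-saturated if $G$ contains no copy of $H$, but there is an ordering $e_1,\ldots,e_k$ of $E(F)\setminus E(G)$ such that for each $i\in\{1,\dots,k\}$ the graph $G\cup\{e_1,\ldots,e_i\}$ contains a copy $H'$ of $H$ with $e_i\in E(H')$. The weak saturation number $\mathrm{wsat}(F,H)$ is the minimum number of edges of a weakly $(F,H)$-saturated graph. *)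

(* Defs.v *)
From mathcomp Require Import all_boot.

Set Implicit Arguments.
Unset Strict Implicit.
Unset Printing Implicit Defensive.

Record sgraph (V : finType) := SGraph {
  edges : {set {set V}};
  edges_card2 : forall e, e \in edges -> #|e| = 2
}.

Lemma complete_card2 (V : finType) (e : {set V}) :
  e \in [set e : {set V} | #|e| == 2] -> #|e| = 2.
Proof. by rewrite inE => /eqP. Qed.

Definition complete (n : nat) : sgraph 'I_n := SGraph (@complete_card2 'I_n).

Lemma complete_bipartite_card2 (a b : nat) (e : {set 'I_a + 'I_b}) :
  e \in [set [set inl i; inr j] | i : 'I_a, j : 'I_b] -> #|e| = 2.
Proof. by case/imset2P => i j _ _ ->; rewrite cards2. Qed.

Definition complete_bipartite (a b : nat) : sgraph ('I_a + 'I_b)%type :=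
  SGraph (@complete_bipartite_card2 a b).

Section WeakSaturation.
Variables V W : finType.
Implicit Types (F : sgraph V) (H : sgraph W) (G D : {set {set V}}).

(* A spanning subgraph of F : sgraph V has vertex set V, so it is represented
   by its edge set G \subset edges F. *)

(* (U, D) is the vertex set and edge set of a subgraph, isomorphic to H, of the
   graph on V with edge set G; f is an isomorphism from H onto it. *)
Definition is_copy H G (U : {set V}) D : bool :=
  (D \subset G) &&
  [exists f : {ffun W -> V},
     [&& injectiveb f,
         f @: [set: W] == U &
         [set f @: e | e : {set W} in edges H] == D]].

Definition contains_copy H G : bool :=
  [exists U : {set V}, exists D : {set {set V}}, is_copy H G U D].

Definition contains_copy_through H G (e : {set V}) : bool :=
  [exists U : {set V}, exists D : {set {set V}},
     is_copy H G U D && (e \in D)].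

(* Indices are shifted by one: tnth e i is the (i+1)-st edge of the ordering,
   and it belongs to take i.+1 e. *)
Definition weakly_saturated F H G : bool :=
  [&& G \subset edges F,
      ~~ contains_copy H G &
      [exists e : #|edges F :\: G|.-tuple {set V},
         perm_eq e (enum (edges F :\: G)) &&
         [forall i : 'I_#|edges F :\: G|,
            contains_copy_through H (G :|: [set x in take i.+1 e])
              (tnth e i)]]].

(* The default #|edges F| bounds every #|G| in the range from above, so it
   affects the value only when no weakly saturated G exists; see wsat_le and
   wsat_attained. *)
Definition wsat F H : nat :=
  \big[minn/#|edges F|]_(G : {set {set V}} | weakly_saturated F H G) #|G|.

Lemma wsat_le F H G : weakly_saturated F H G -> wsat F H <= #|G|.
Proof.
move=> wG; rewrite /wsat; have : G \in index_enum _ by rewrite mem_index_enum.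
elim: (index_enum _) => //= G1 r IHr; rewrite inE big_cons => /predU1P[<-|Gr].
  by rewrite wG geq_minl.
by case: ifP => _; rewrite ?geq_min IHr ?orbT.
Qed.

Lemma wsat_attained F H G0 :
  weakly_saturated F H G0 ->
  exists2 G, weakly_saturated F H G & wsat F H = #|G|.
Proof.
move=> w0; have : wsat F H <= #|G0| by apply: wsat_le.
have : (exists2 G, weakly_saturated F H G & wsat F H = #|G|)
       \/ wsat F H = #|edges F|.
  rewrite /wsat; elim/big_ind: _ => [|x y IHx IHy|G wG]; first by right.
  - by rewrite /minn; case: ifP.
  - by left; exists G.
case=> // -> le0; exists G0 => //; apply/eqP; rewrite eqn_leq le0.
by case/andP: w0 => /subset_leq_card.
Qed.

End WeakSaturation.

(* Main.v *)
(** A graph from which [F] is reached by adding edges one at a time, each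
    completing a copy of [H], may be assumed [H]-free: deleting an edge of a
    copy of [H] preserves the property, since that edge can be added back first.
    So it is enough to exhibit such a graph with few edges.

    Partition the vertices into [A], [U], [P], [W] with [#|A| = #|P| = s - 1]
    and [#|U| = t - s], and let [K0 \subset K \subset W] have sizes [s - 1] and [s].
    Start from the clique on [A :|: U] and all edges [A]-[W], [U]-[K], [P]-[K0].
    Then the edges [U]-[W], [P]-[W], [P]-[A :|: U], [W]-[W], [P]-[P] can be
    added, in this order. *)
Require Import Defs.
From mathcomp Require Import all_boot zify.

Set Implicit Arguments.
Unset Strict Implicit.
Unset Printing Implicit Defensive.

(** * Percolation and weak saturation *)

Section Percolation.
Variables V W : finType.
Variables (F : sgraph V) (H : sgraph W).
Implicit Types (G E : {set {set V}}) (e : {set V}).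

Lemma contains_copy_through_sub G G' e :
  G \subset G' -> contains_copy_through H G e -> contains_copy_through H G' e.
Proof.
move=> sGG' /existsP[U /existsP[D /andP[/andP[sDG iso] eD]]].
apply/existsP; exists U; apply/existsP; exists D.
by rewrite /is_copy (subset_trans sDG sGG') iso.
Qed.

(** Weak saturation with the [H]-freeness of the starting graph dropped. A step may re-add an edge
    that is already present, so derivations can be built without tracking which edges are new; an
    explicit ordering is extracted only once, in [percolates_order]. *)
Inductive percolates G : Prop :=
| percolates_full of edges F \subset G
| percolates_step e of e \in edges F &
    contains_copy_through H (e |: G) e & percolates (e |: G).

(** Each edge of [E] has its copy over [G] alone, and such a copy survives when further edges are
    added. So the order within [E] is irrelevant, and [enum E] serves. *)
Lemma percolates_add G E :
  (forall e, e \in E -> e \in G \/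
     e \in edges F /\ contains_copy_through H (e |: G) e) ->
  percolates (G :|: E) -> percolates G.
Proof.
rewrite -(set_enum E); move: (enum E) => r.
elim: r G => [|e r IHr] G addE.
  by rewrite set_nil setU0.
rewrite set_cons setUCA setUA => perc.
have {}perc : percolates (e |: G).
  apply: IHr perc => e'; rewrite inE => e'r.
  have /addE[e'G|[e'F copy]] : e' \in [set x in e :: r].
  - by rewrite !inE e'r orbT.
  - by left; rewrite inE e'G orbT.
  right; split=> //; apply: contains_copy_through_sub copy.
  by apply: setUS; apply: subsetUr.
have /addE[eG|[eF copy]] : e \in [set x in e :: r] by rewrite !inE eqxx.
  by rewrite (setUidPr _) ?sub1set in perc.
exact: percolates_step eF copy perc.
Qed.

Lemma percolates_order G : G \subset edges F -> percolates G ->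
  exists2 r : seq {set V}, perm_eq r (enum (edges F :\: G)) &
    forall i, i < size r ->
      contains_copy_through H (G :|: [set x in take i.+1 r]) (nth set0 r i).
Proof.
move=> sGF perc; elim: perc sGF => {G} [G sFG|G e eF copy _ IH] sGF.
  exists [::] => //; suff -> : edges F :\: G = set0 by rewrite enum_set0.
  by apply/eqP; rewrite setD_eq0.
have /IH[r pr cr] : e |: G \subset edges F by rewrite subUset sub1set eF.
(* A step that re-adds a present edge is left out of the ordering. *)
have [eG|eG] := boolP (e \in G).
  have eGG : e |: G = G by apply/setUidPr; rewrite sub1set.
  by rewrite eGG in pr cr; exists r.
exists (e :: r).
  apply: uniq_perm; last 1 first.
  - move=> x; rewrite inE (perm_mem pr) !mem_enum !inE.
    by case: eqP => // ->; rewrite eG.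
  - by rewrite /= (perm_uniq pr) enum_uniq (perm_mem pr) mem_enum !inE eqxx.
  - exact: enum_uniq.
case=> [_|i ilt] /=; first by rewrite take0 set_cons setUCA set_nil setU0.
by rewrite set_cons setUCA setUA; apply: cr.
Qed.

Lemma percolates_weakly_saturated G : edges H != set0 ->
  G \subset edges F -> percolates G ->
  exists2 G', weakly_saturated F H G' & #|G'| <= #|G|.
Proof.
move=> H0; have [m] := ubnP #|G|; elim: m G => // m IHm G ltGm sGF perc.
have [|noH] := boolP (contains_copy H G); last first.
  exists G => //; rewrite /weakly_saturated sGF noH /=.
  have [r pr cr] := percolates_order sGF perc.
  have sz : size r == #|edges F :\: G| by rewrite (perm_size pr) -cardE.
  apply/existsP; exists (Tuple sz); rewrite pr /=; apply/forallP => i.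
  by rewrite (tnth_nth set0); apply: cr; rewrite (eqP sz).
case/existsP=> U /existsP[D copyD]; have := copyD.
case/andP=> sDG /existsP[f /and3P[_ _ /eqP defD]].
(* As [H] has an edge [h], the copy found in [G] has an edge that can be deleted. *)
have [h hH] := set0Pn _ H0.
have eD : f @: h \in D by rewrite -defD imset_f.
set e := f @: h in eD; have eG := subsetP sDG _ eD.
have sG'F : G :\ e \subset edges F by rewrite (subset_trans _ sGF) ?subD1set.
have lt : #|G :\ e| < #|G| by rewrite [X in _ < X](cardsD1 e) eG.
have [||G' wG' le] := IHm (G :\ e) _ sG'F.
- exact: leq_trans lt ltGm.
(* Putting [e] back restores [G], and the copy [D] through [e] justifies this first step. *)
- apply: (@percolates_step _ e); rewrite ?setD1K //; first exact: (subsetP sGF).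
  by apply/existsP; exists U; apply/existsP; exists D; rewrite copyD.
by exists G' => //; apply: leq_trans le (ltnW lt).
Qed.

End Percolation.

Lemma cards_subset_exists (T : finType) (X : {set T}) k :
  k <= #|X| -> exists2 Y : {set T}, Y \subset X & #|Y| = k.
Proof.
case/card_geqP=> r [ur <- sr]; exists [set x in r].
  by apply/subsetP=> x; rewrite inE => /sr.
by rewrite cardsE; apply/card_uniqP.
Qed.

Lemma imset_set2 (T U : finType) (f : T -> U) x y :
  f @: [set x; y] = [set f x; f y].
Proof. by rewrite imsetU1 imset_set1. Qed.

(** * Copies of complete bipartite graphs *)

Section CompleteBipartite.
Variable V : finType.
Implicit Types (S T : {set V}) (G : {set {set V}}).

Definition join S T : {set {set V}} := [set [set x; y] | x in S, y in T].

Lemma mem_join S T x y : x \in S -> y \in T -> [set x; y] \in join S T.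
Proof. exact: imset2_f. Qed.

Lemma card_join S T : #|join S T| <= #|S| * #|T|.
Proof. by rewrite /join curry_imset2X -cardsX leq_imset_card. Qed.

Lemma join_copy_through s t S T G e :
  #|S| = s -> #|T| = t -> [disjoint S & T] -> join S T \subset G ->
  e \in join S T -> contains_copy_through (complete_bipartite s t) G e.
Proof.
move=> cS cT dST sub eST.
pose f : {ffun 'I_s + 'I_t -> V} := [ffun z => match z with
  | inl i => enum_val (cast_ord (esym cS) i)
  | inr j => enum_val (cast_ord (esym cT) j) end].
have fl i : f (inl i) \in S by rewrite ffunE enum_valP.
have fr j : f (inr j) \in T by rewrite ffunE enum_valP.
have defE : [set f @: e | e : {set _} in edges (complete_bipartite s t)]
    = join S T.
  apply/setP=> d; apply/imsetP/imset2P.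
    case=> _ /imset2P[i j _ _ ->] ->; exists (f (inl i)) (f (inr j)) => //.
    by rewrite imset_set2.
  case=> x y xS yT ->.
  exists [set inl (cast_ord cS (enum_rank_in xS x));
              inr (cast_ord cT (enum_rank_in yT y))]; first exact: imset2_f.
  by rewrite imset_set2 !ffunE !cast_ordK !enum_rankK_in.
apply/existsP; exists (f @: setT); apply/existsP; exists (join S T).
rewrite eST andbT /is_copy sub /=; apply/existsP; exists f.
rewrite defE !eqxx !andbT; apply/injectiveP => -[i|i] [j|j] eqf.
- by move: eqf; rewrite !ffunE => /enum_val_inj/cast_ord_inj->.
- by have := disjointFr dST (fl i); rewrite eqf fr.
- by have := disjointFr dST (fl j); rewrite -eqf fr.
- by move: eqf; rewrite !ffunE => /enum_val_inj/cast_ord_inj->.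
Qed.

(** The sides of the copy are [x |: S] and [y |: T]. They are disjoint because a common vertex other
    than [x = y] would give a one-element edge in [G]. *)
Lemma new_edge_copy_through s t S T G x y :
  (forall e, e \in G -> #|e| = 2) -> 0 < s -> 0 < t ->
  #|S| = s.-1 -> #|T| = t.-1 -> x \notin S -> y \notin T -> x != y ->
  {in S & T, forall a b, [set a; b] \in G} ->
  {in T, forall b, [set x; b] \in G} -> {in S, forall a, [set a; y] \in G} ->
  contains_copy_through (complete_bipartite s t) ([set x; y] |: G) [set x; y].
Proof.
move=> G2 s0 t0 cS cT xS yT xy ST xT Sy.
have nloop z : [set z; z] \notin G.
  by apply/negP=> /G2; rewrite setUid cards1.
apply: (@join_copy_through _ _ (x |: S) (y |: T)).
- by rewrite cardsU1 xS cS; lia.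
- by rewrite cardsU1 yT cT; lia.
- apply/pred0P=> z /=; apply/negP; rewrite !inE.
  case/andP=> /orP[/eqP->|zS] /orP[/eqP E|zT].
  + by rewrite E eqxx in xy.
  + by have := nloop x; rewrite xT.
  + by have := nloop z; rewrite {2}E Sy.
  + by have := nloop z; rewrite ST.
- apply/subsetP=> _ /imset2P[a b + + ->]; rewrite !inE.
  case/orP=> [/eqP->|aS] /orP[/eqP->|bT]; rewrite ?eqxx //.
  + by rewrite xT ?orbT.
  + by rewrite Sy ?orbT.
  + by rewrite ST ?orbT.
- by apply: imset2_f; rewrite !inE eqxx.
Qed.

End CompleteBipartite.

(** The guard [x != y] lets [X] and [Y] overlap; [adjacent G X X] says that [X] is a clique. *)
Definition adjacent (V : finType) (G : {set {set V}}) (X Y : {set V}) :=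
  forall x y, x \in X -> y \in Y -> x != y -> [set x; y] \in G.

Lemma adjacent_sub (V : finType) (G G' : {set {set V}}) (X Y : {set V}) :
  G \subset G' -> adjacent G X Y -> adjacent G' X Y.
Proof. by move=> /subsetP sGG' adjG x y xX yY xy; apply/sGG'/adjG. Qed.

(** One stage of the percolation, in continuation form: the last hypothesis takes an arbitrary
    larger [G'], so later stages rely only on adjacency facts and never on an explicit edge set. *)
Lemma percolates_join s t n (G : {set {set 'I_n}}) (X Y : {set 'I_n}) :
  1 < s -> s < t -> G \subset edges (complete n) ->
  (forall x y, x \in X -> y \in Y -> x != y -> [set x; y] \in G \/
     exists S T : {set 'I_n},
       [/\ #|S| = s.-1, #|T| = t.-1, x \notin S, y \notin T &
       [/\ {in S & T, forall a b, [set a; b] \in G},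
           {in T, forall b, [set x; b] \in G} &
           {in S, forall a, [set a; y] \in G}]]) ->
  (forall G' : {set {set 'I_n}}, G \subset G' ->
     G' \subset edges (complete n) -> adjacent G' X Y ->
     percolates (complete n) (complete_bipartite s t) G') ->
  percolates (complete n) (complete_bipartite s t) G.
Proof.
move=> s1 st sGF add next.
(* The intersection discards the singletons that [join X Y] contains when [X] and [Y] meet. *)
apply: (@percolates_add _ _ _ _ _ (join X Y :&: edges (complete n))).
  move=> e /setIP[/imset2P[x y xX yY ->] exy].
  have xy : x != y by move: exy; rewrite inE cards2; case: (x != y).
  have [|[S [T [cS cT xS yT [ST xT Sy]]]]] := add x y xX yY xy; first by left.
  right; split=> //; apply: (new_edge_copy_through _ _ _ cS cT) => //;
    [|exact: ltnW|exact: ltn_trans (ltnW s1) st].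
  by move=> d /(subsetP sGF); rewrite inE => /eqP.
apply: next; first exact: subsetUl.
  by rewrite subUset sGF subsetIr.
by move=> x y xX yY xy; rewrite !inE cards2 xy mem_join ?orbT.
Qed.

(** * The seed graph: edge count and percolation *)

Section Construction.
Variables (s t n : nat) (A U P W K K0 : {set 'I_n}).
Hypotheses (s1 : 1 < s) (st : s < t).
Hypotheses (cA : #|A| = s.-1) (cU : #|U| = t - s) (cP : #|P| = s.-1).
Hypothesis cW : s + t - 2 <= #|W|.
Hypotheses (sKW : K \subset W) (cK : #|K| = s).
Hypotheses (sK0K : K0 \subset K) (cK0 : #|K0| = s.-1).
Hypotheses (dAU : [disjoint A & U]) (dAUP : [disjoint A :|: U & P]).
Hypothesis dW : W = ~: (A :|: U :|: P).

Let C := A :|: U.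

Definition seed_graph : {set {set 'I_n}} :=
  [set e : {set 'I_n} | e \subset C & #|e| == 2]
    :|: join A W :|: join U K :|: join P K0.

Lemma card_C : #|C| = t.-1.
Proof. by rewrite cardsU (disjoint_setI0 dAU) cards0 cA cU; lia. Qed.

Lemma card_seed_graph : #|seed_graph| <= (s - 1) * (n - s) + 'C(t, 2).
Proof.
have cVW : t.-1 + s.-1 + #|W| = n.
  rewrite dW -[in RHS](card_ord n) -(cardsC (A :|: U :|: P)).
  by rewrite [in RHS]cardsU (disjoint_setI0 dAUP) cards0 card_C cP; lia.
have cC : #|[set e : {set 'I_n} | e \subset C & #|e| == 2]| = 'C(t.-1, 2).
  by rewrite cards_draws card_C.
have := card_join A W; have := card_join U K; have := card_join P K0.
rewrite cA cU cK cP cK0 => h3 h2 h1.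
rewrite /seed_graph.
apply: leq_trans (leq_trans (leq_card_setU _ _) (leq_add (leq_trans
  (leq_card_setU _ _) (leq_add (leq_card_setU _ _) (leqnn _))) (leqnn _))) _.
rewrite cC; have -> : 'C(t, 2) = 'C(t.-1, 2) + t.-1.
  by case: (t) st => // t' _; rewrite binS bin1 addnC.
(* This substitution removes most truncated subtractions. The upper bounds on the four pieces then
   add up to exactly the target. *)
have [p defs] : exists p, s = p.+1 by exists s.-1; lia.
have [d deft] : exists d, t = s + d by exists (t - s); lia.
have -> : n - s = p + d + #|W| - 1 by lia.
move: h1 h2 h3; rewrite deft defs; clear; nia.
Qed.

Lemma seed_graph_sub : seed_graph \subset edges (complete n).
Proof.
have sub (X Y : {set 'I_n}) :
    [disjoint X & Y] -> join X Y \subset edges (complete n).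
  move=> dXY; apply/subsetP=> _ /imset2P[x y xX yY ->]; rewrite inE cards2.
  by have [xy|//] := eqVneq x y; rewrite -xy (disjointFr dXY) in yY.
have dXW (X : {set 'I_n}) : X \subset A :|: U :|: P -> [disjoint X & W].
  by move=> sX; rewrite dW -subsets_disjoint.
rewrite !subUset !sub ?andbT.
- by apply/subsetP=> e; rewrite !inE => /andP[].
- by apply: disjointWr (subset_trans sK0K sKW) (dXW _ _); rewrite subsetUr.
- by apply: disjointWr sKW (dXW _ _); rewrite -setUA setUCA subsetUl.
- by apply: dXW; rewrite -setUA subsetUl.
Qed.

Lemma seed_graph_percolates :
  percolates (complete n) (complete_bipartite s t) seed_graph.
Proof.
have [sW tW] : s.-1 <= #|W| /\ t.-1 <= #|W| by move: cW s1 st; clear; lia.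
have dCW : [disjoint C & W] by rewrite dW -subsets_disjoint subsetUl.
have dPW : [disjoint P & W] by rewrite dW -subsets_disjoint subsetUr.
have VE x : [|| x \in C, x \in W | x \in P].
  by rewrite dW !inE; case: (_ || _) (x \in P) => [[]|[]].
have [uKW uK0W] := (subsetP sKW, subsetP (subset_trans sK0K sKW)).
have [uAC uUC] := (subsetP (subsetUl A U), subsetP (subsetUr A U)).
have dis (G : {set {set 'I_n}}) (X Y : {set 'I_n}) :
    [disjoint X & Y] -> adjacent G X Y -> {in X & Y, forall a b, [set a; b] \in G}.
  move=> dXY adj a b aX bY; apply: adj => //.
  by apply: contraTneq bY => <-; rewrite (disjointFr dXY).
have sym (G : {set {set 'I_n}}) (X Y : {set 'I_n}) :
    {in X & Y, forall a b, [set a; b] \in G} ->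
    {in Y & X, forall a b, [set a; b] \in G}.
  by move=> adj a b aY bX; rewrite setUC adj.
have CC0 : adjacent seed_graph C C.
  by move=> x y xC yC xy; rewrite !inE subUset !sub1set xC yC cards2 xy.
have AW0 : {in A & W, forall a b, [set a; b] \in seed_graph}.
  by move=> x y xA yW; rewrite !inE (mem_join xA yW) orbT.
have UK0 : {in U & K, forall a b, [set a; b] \in seed_graph}.
  by move=> x y xU yK; rewrite !inE (mem_join xU yK) orbT.
have PK00 : {in P & K0, forall a b, [set a; b] \in seed_graph}.
  by move=> x y xP yK; rewrite !inE (mem_join xP yK) orbT.
have dUK : [disjoint U & K] by apply: disjointW dCW; rewrite ?subsetUr.
apply: (percolates_join (X := U) (Y := W) s1 st seed_graph_sub).
  move=> x y xU yW xy; have [yK|yK] := boolP (y \in K).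
    by left; apply: UK0.
  (* Here [#|K| = s] is what brings the second set to size [(t - s - 1) + s = t - 1]. *)
  right; exists A, (U :\ x :|: K); split=> //.
  - rewrite cardsU (_ : _ :&: _ = set0) ?cards0 ?cK; last first.
      by apply/disjoint_setI0/(disjointWl _ dUK)/subD1set.
    by move: cU s1 st; rewrite (cardsD1 x) xU; clear; lia.
  - by rewrite (disjointFl dAU xU).
  - apply/negP=> /setUP[/setD1P[_ /uUC]|]; last exact/negP.
    by rewrite (disjointFl dCW yW).
  split=> [a b aA|b|a aA]; last exact: AW0.
    case/setUP=> [/setD1P[_ bU]|bK]; last exact: AW0 (uKW _ bK).
    apply: CC0; [exact: uAC | exact: uUC | ].
    by apply: contraTneq bU => <-; rewrite (disjointFr dAU).
  case/setUP=> [/setD1P[bx bU]|bK]; last exact: UK0.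
  by apply: CC0; [exact: uUC | exact: uUC | rewrite eq_sym].
move=> G1 s01 sG1 /dis UW1; have /subsetP u01 := s01.
have CC1 := adjacent_sub s01 CC0.
have {UW1} CW1 : {in C & W, forall a b, [set a; b] \in G1}.
  move=> a b /setUP[aA|aU] bW; first exact/u01/AW0.
  by apply: UW1 => //; apply: disjointWl dCW; apply: subsetUr.
apply: (percolates_join (X := W) (Y := P) s1 st sG1).
  move=> x y xW yP xy; have [xK|xK] := boolP (x \in K0).
    by left; apply/u01/(sym _ _ _ PK00).
  (* The vertex of [W] goes on the side of size [s]: it sees all [t - 1] vertices of [C], while [y]
     in [P] sees the [s - 1] vertices of [K0]. *)
  right; exists K0, C; split=> //; first exact: card_C.
    by rewrite (disjointFl dAUP yP).
  split=> [a b /uK0W aW bC|b bC|a aK]; try exact: (sym _ _ _ CW1).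
  exact/u01/(sym _ _ _ PK00).
move=> G2 s12 sG2 /dis; rewrite disjoint_sym => /(_ dPW) WP2.
have PW2 := sym _ _ _ WP2; have /subsetP u12 := s12.
have CC2 := adjacent_sub s12 CC1.
apply: (percolates_join (X := P) (Y := C) s1 st sG2).
  move=> x y xP yC xy; right.
  (* The clique [C] supplies neighbours of [y]; since [C] and [P] are now both fully joined to [W],
     any [t - 1] vertices of [W] complete the copy. *)
  have [|S sS cS] := @cards_subset_exists _ (C :\ y) s.-1.
    by move: card_C s1 st; rewrite (cardsD1 y) yC; clear; lia.
  have [|T /subsetP sT cT] := @cards_subset_exists _ W t.-1; first exact: tW.
  have uS a : a \in S -> a != y /\ a \in C.
    by move/(subsetP sS)/setD1P.
  exists S, T; split=> //.
  - by apply/negP=> /uS[_]; rewrite (disjointFl dAUP xP).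
  - by apply/negP=> /sT; rewrite (disjointFr dCW yC).
  split=> [a b /uS[_ aC] /sT bW|b /sT bW|a /uS[ay aC]].
  - exact/u12/CW1.
  - exact: PW2.
  - exact: CC2.
move=> G3 s23 sG3 /dis; rewrite disjoint_sym => /(_ dAUP) PC3.
have /subsetP u23 := s23; have CC3 := adjacent_sub s23 CC2.
apply: (percolates_join (X := W) (Y := W) s1 st sG3).
  (* All edges between [P], [C] and [W] are present by now, so [P] and [C] serve for every pair in
     [W]. *)
  move=> x y xW yW xy; right; exists P, C; split=> //; first exact: card_C.
  - by rewrite (disjointFl dPW xW).
  - by rewrite (disjointFl dCW yW).
  split=> [||a aP]; [exact: PC3 | | exact/u23/PW2].
  by move=> b bC; apply/u23/u12/(sym _ _ _ CW1).
move=> G4 s34 sG4 WW4; have /subsetP u34 := s34.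
have CC4 := adjacent_sub s34 CC3.
apply: (percolates_join (X := P) (Y := P) s1 st sG4).
  move=> x y xP yP xy; right.
  have [|S sS cS] := @cards_subset_exists _ W s.-1; first exact: sW.
  (* Both sets lie in the clique [W] and must be disjoint, so [W] needs [(s - 1) + (t - 1)]
     vertices, which is [cW]. *)
  have [|T sT cT] := @cards_subset_exists _ (W :\: S) t.-1.
    by move: cW s1; rewrite cardsD (setIidPr sS) cS; clear; lia.
  have uS := subsetP sS.
  have uT a : a \in T -> a \notin S /\ a \in W by move/(subsetP sT)/setDP=> [].
  exists S, T; split=> //.
  - by apply/negP=> /uS; rewrite (disjointFr dPW xP).
  - by apply/negP=> /uT[_]; rewrite (disjointFr dPW yP).
  split=> [a b aS /uT[bS bW]|b /uT[_ bW]|a /uS aW].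
  - by apply: WW4 (uS _ aS) bW _; apply: contraNneq bS => <-.
  - exact/u34/u23/PW2.
  - exact/u34/u23/WP2.
move=> G5 s45 sG5 PP5; apply: percolates_full; have /subsetP u45 := s45.
apply/subsetP=> e; rewrite inE => /cards2P[x [y [xy ->]]].
have CW5 : {in C & W, forall a b, [set a; b] \in G5}.
  by move=> a b aC bW; apply/u45/u34/u23/u12/CW1.
have PW5 : {in P & W, forall a b, [set a; b] \in G5}.
  by move=> a b aP bW; apply/u45/u34/u23/PW2.
have PC5 : {in P & C, forall a b, [set a; b] \in G5}.
  by move=> a b aP bC; apply/u45/u34/PC3.
(* [C], [W] and [P] cover the vertices, so every edge falls under one of the completed stages or
   inside the clique [C]. *)
case/or3P: (VE x) => xX; case/or3P: (VE y) => yY;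
  try by [apply: CW5 | apply: PW5 | apply: PC5 | apply: PP5
         | apply: sym CW5 _ _ _ _ | apply: sym PW5 _ _ _ _
         | apply: sym PC5 _ _ _ _].
  exact/u45/CC4.
exact/u45/WW4.
Qed.

End Construction.

Theorem proposition14 (s t n : nat) (hs : 2 <= s) (hst : s < t)
    (hn : 2 * (s + t) - 3 <= n) :
  wsat (complete n) (complete_bipartite s t) <= (s - 1) * (n - s) + 'C(t, 2).
Proof.
have [|A _ cA] := @cards_subset_exists _ [set: 'I_n] s.-1.
  by rewrite cardsT card_ord; lia.
have [|U sU cU] := @cards_subset_exists _ (~: A) (t - s).
  by rewrite cardsCs setCK card_ord cA; lia.
have dAU : [disjoint A & U] by rewrite disjoint_sym disjoints_subset.
have cAU : #|A :|: U| = t.-1.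
  by rewrite cardsU (disjoint_setI0 dAU) cards0 cA cU; move: hs hst; clear; lia.
have [|P sP cP] := @cards_subset_exists _ (~: (A :|: U)) s.-1.
  by rewrite cardsCs setCK card_ord cAU; lia.
have dAUP : [disjoint A :|: U & P] by rewrite disjoint_sym disjoints_subset.
(* [A], [U] and [P] occupy [s + t - 2] vertices; the lower bound on [n] leaves at least as many for
   [W]. *)
have cW : s + t - 2 <= #|~: (A :|: U :|: P)|.
  rewrite cardsCs setCK card_ord cardsU (disjoint_setI0 dAUP) cards0 cAU cP.
  lia.
have [|K sK cK] := @cards_subset_exists _ (~: (A :|: U :|: P)) s; first by lia.
have [|K0 sK0 cK0] := @cards_subset_exists _ K s.-1; first by lia.
have [||G wG le] := percolates_weakly_saturated _ _ (seed_graph_percolates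
  hs hst cA cU cP cW sK cK sK0 cK0 dAU dAUP erefl).
- apply/set0Pn; exists [set inl (Ordinal (ltnW hs));
                           inr (Ordinal (ltn_trans (ltnW hs) hst))].
  exact: imset2_f.
- exact: seed_graph_sub.
apply: leq_trans (wsat_le wG) (leq_trans le _).
exact: card_seed_graph.
Qed.
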